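(* Let $n$ be an even positive integer, $0<\alpha<1$, $c>0$, and let $q=1-c/n^{\alpha}$, with $0<q<1$. Let $X$ be the random walk with $n$ steps, $n/2$ of them up and $n/2$ of them down, distributed under the invariant measure of the asymmetric exclusion process with parameter $q$, and let $L_X$ denote the length of the longest increasing (non-decreasing) subsequence of the random walk. Then for all $r>0$, $$\mathbb{P}\left(|L_X-\mathbb{E}L_X|\geq r\right)\leq 6\exp\left(-\frac{r}{2}\sqrt{\frac{c^2}{n^{2\alpha}}}\right).$$
   Context: A walk is represented by its step configuration $\eta\in\{0,1\}^n$ with $\sum_{i=1}^n\eta_i=n/2$, where $\eta_i=1$ is an up step ($+1$) and $\eta_i=0$ a down step ($-1$) at position $i$; the height of the walk at position $m$ is $X_m=\sum_{i=1}^m(2\eta_i-1)$. The configuration is also viewed as a particle configuration, with $\eta_i=1$ meaning a particle at site $i$. The asymmetric exclusion process is the Markov chain on these configurations in which, at each step, $i$ is chosen uniformly in $\{1,\dots,n-1\}$; if $\eta_i=\eta_{i+1}$ nothing changes; if $\eta_i=1,\eta_{i+1}=0$ the two values are switched with probability $1-q/2$; if $\eta_i=0,\eta_{i+1}=1$ they are switched with probability $q/2$. The length of the longest increasing (non-decreasing) subsequence of the walk is $$L_X=\max\{k: \text{there exist } 1\le i_1<i_2<\dots<i_k\le n \text{ with } X_{i_1}\leq X_{i_2}\leq\dots\leq X_{i_k}\}.$$ *)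

(* Defs.v *)
From HB Require Import structures.
From mathcomp Require Import all_boot all_order all_fingroup all_algebra.
From mathcomp Require Import all_classical all_reals all_analysis.
Set Implicit Arguments.
Unset Strict Implicit.
Unset Printing Implicit Defensive.
Import Order.TTheory GRing.Theory Num.Theory.
Local Open Scope ring_scope.

(* Sites are 0-based: [i : 'I_n] stands for the site i+1 of {1, ..., n}. *)
Record config (n : nat) := Config {
  occ :> {ffun 'I_n -> bool};
  _ : (\sum_(i < n) occ i == n./2)%N
}.
HB.instance Definition _ (n : nat) := [isSub for @occ n].
HB.instance Definition _ (n : nat) := [Finite of config n by <:].

Lemma bond_right_subproof (n : nat) (i : 'I_n.-1) : (i.+1 < n)%N.
Proof. by case: n i => [|n] [i]. Qed.

(* A bond [i : 'I_n.-1] joins the neighbouring sites i and i+1. *)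
Definition bond_left (n : nat) (i : 'I_n.-1) : 'I_n :=
  widen_ord (leq_pred n) i.
Definition bond_right (n : nat) (i : 'I_n.-1) : 'I_n :=
  Ordinal (bond_right_subproof i).

Definition swap (n : nat) (i : 'I_n.-1) (eta : config n) : {ffun 'I_n -> bool} :=
  [ffun k => eta (tperm (bond_left i) (bond_right i) k)].

Definition swap_prob (R : realType) (q : R) (n : nat) (i : 'I_n.-1)
    (eta : config n) : R :=
  match eta (bond_left i), eta (bond_right i) with
  | true, false => 1 - q / 2
  | false, true => q / 2
  | _, _ => 0
  end.

Definition asep_kernel (R : realType) (q : R) (n : nat) (eta xi : config n) : R :=
  (n.-1)%:R^-1 * \sum_(i < n.-1)
    (swap_prob q i eta * (occ xi == swap i eta)%:R
     + (1 - swap_prob q i eta) * (xi == eta)%:R).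

Definition is_distribution (R : realType) (T : finType) (mu : T -> R) : Prop :=
  (forall x, 0 <= mu x) /\ \sum_x mu x = 1.

(* For 0 < q < 1 the chain is irreducible, so this determines [mu]. *)
Definition asep_invariant (R : realType) (q : R) (n : nat)
    (mu : config n -> R) : Prop :=
  is_distribution mu /\
  forall xi, \sum_eta mu eta * asep_kernel q eta xi = mu xi.

Definition Pr (R : realType) (T : finType) (mu : T -> R) (A : pred T) : R :=
  \sum_(x | A x) mu x.

Definition Ex (R : realType) (T : finType) (mu : T -> R) (f : T -> R) : R :=
  \sum_x mu x * f x.

Definition height (n : nat) (eta : config n) (m : nat) : int :=
  \sum_(i < n | (i < m)%N) (2 * (eta i)%:Z - 1).

(* The entry [i : 'I_n] of [t] stands for the position i+1 in {1, ..., n}, so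
   position 0 is excluded.  The bound [k <= n] only makes the range finite:
   a strictly increasing sequence of positions has at most n terms. *)
Definition LIS (n : nat) (eta : config n) : nat :=
  \max_(k < n.+1 | [exists t : k.-tuple 'I_n,
      sorted ltn [seq val i | i <- t] &&
      sorted <=%R [seq height eta i.+1 | i : 'I_n <- t]]) k.

(* Main.v *)
Require Import Defs.
From mathcomp Require Import all_boot all_order all_fingroup all_algebra.
From mathcomp Require Import all_classical all_reals all_analysis.
From mathcomp Require Import zify ring lra.
Import Order.TTheory GRing.Theory Num.Theory.
Local Open Scope ring_scope.

(** Write k = n/2, d = 1 - q, and let U be the number of up steps among the
    first k steps, i.e. the number of particles in the left half.  Everything
    follows from two facts.

    First, L_X is k + 1 up to an error controlled by U: always
    k + 1 - 2U <= L_X <= k + 1.  Two consecutive terms of a nondecreasing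
    subsequence are separated by at least one up step, and there are only k of
    them, which gives the upper bound ([LIS_le]).  For the lower bound
    ([LIS_lower]) follow the walk from time k, where its height is 2U - k, to
    time n, where its height is 0: the times at which it reaches a new maximum
    form an increasing subsequence with at least k - 2U + 1 terms.

    Secondly, U has an exponential moment at scale 1 / d.  The drift pushes
    particles to the right with odds y = (2 - q) / q, and in the Gärtner
    (discrete Cole-Hopf) variables y ^ N_m, where N_m counts the particles in
    the first m sites, the generator of the exclusion process becomes linear.
    Hence under any invariant measure z_m = E [y ^ N_m] solves
    z_(m+2) - z_(m+1) = y (z_(m+1) - z_m), with z_0 = 1 and z_n = y ^ k.  The
    solution at m = k is z_k = 2 y^k / (1 + y^k), so that E [y ^ U] <= 2
    ([exp_particles_half_le2]).  As exp d <= y, also E [exp (d U)] <= 2.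

    To conclude, put D = k + 1 - L_X, so that 0 <= D <= 2U and
    E D <= 2 E U <= 2 / d.  If r d <= 2 the claimed bound exceeds 1.  Otherwise
    r > E D, so D cannot fall below its mean by r, and a deviation forces
    D >= r, hence U >= r / 2, which by Markov's inequality has probability at
    most 2 exp (- r d / 2). *)

(** * Particle counts and heights *)

Definition particles {n : nat} (eta : config n) (m : nat) : nat :=
  (\sum_(j < n | (j < m)%N) eta j)%N.

Lemma particles0 {n : nat} (eta : config n) : particles eta 0 = 0%N.
Proof. by rewrite /particles big_pred0. Qed.

Lemma particlesS {n : nat} (eta : config n) (i : 'I_n) :
  particles eta i.+1 = (particles eta i + eta i)%N.
Proof.
rewrite /particles (bigD1 i) ?ltnS ?leqnn //= addnC; congr addn.
by apply: eq_bigl => j; rewrite ltnS [(j < i)%N]ltn_neqAle andbC.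
Qed.

Lemma particles_total {n : nat} (eta : config n) : particles eta n = n./2.
Proof.
have /eqP <- := valP eta; rewrite /particles.
by apply: eq_bigl => j; rewrite ltn_ord.
Qed.

Lemma particles_le {n : nat} (eta : config n) (m : nat) :
  (particles eta m <= n./2)%N.
Proof.
rewrite -(particles_total eta) /particles big_mkcond [leqRHS]big_mkcond /=.
by apply: leq_sum => j _; rewrite ltn_ord; case: ifP.
Qed.

Lemma heightE {n : nat} (eta : config n) (m : nat) : (m <= n)%N ->
  height eta m = 2 * (particles eta m)%:Z - m%:Z.
Proof.
elim: m => [|m IHm] lemn; first by rewrite particles0 /height big_pred0.
rewrite (particlesS eta (Ordinal lemn)) /height.
rewrite (bigD1 (Ordinal lemn)) ?ltnS ?leqnn //=.
under eq_bigl => j do rewrite ltnS -val_eqE /= andbC -ltn_neqAle.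
move: (IHm (ltnW lemn)); rewrite /height => ->.
lia.
Qed.

(** * Bounds on the longest increasing subsequence *)

Definition increasing_positions {n : nat} (eta : config n) (s : seq 'I_n) :=
  sorted ltn [seq val i | i <- s] &&
  sorted <=%R [seq height eta i.+1 | i : 'I_n <- s].

(** If m < m' and the height at m' is at least that at m, then some step between
    them is up; so each term after the first uses up one of the n/2 up steps. *)
Lemma size_increasing_positions {n : nat} (eta : config n) (s : seq 'I_n) :
  increasing_positions eta s -> (size s <= (n./2).+1)%N.
Proof.
case: s => // i s /andP[/= ltn_s le_s].
suff: (size s + particles eta i.+1 <= particles eta (last i s).+1)%N.
  by have := particles_le eta (last i s).+1; lia.
elim: s i ltn_s le_s => //= j s IHs i /andP[lt_ij ltn_s] /andP[le_ij le_s].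
have := IHs j ltn_s le_s; move: le_ij; rewrite !heightE //; lia.
Qed.

Lemma LIS_le {n : nat} (eta : config n) : (LIS eta <= (n./2).+1)%N.
Proof.
apply/bigmax_leqP => k /existsP[t incr_t].
by rewrite -[leqLHS](size_tuple t); apply: (size_increasing_positions eta).
Qed.

Lemma LIS_ge {n : nat} (eta : config n) (s : seq 'I_n) :
  increasing_positions eta s -> (size s <= LIS eta)%N.
Proof.
move=> incr_s; have lt_s : (size s < n.+1)%N.
  have /card_uniqP <- : uniq s.
    rewrite -(map_inj_uniq val_inj).
    by case/andP: incr_s => /(sorted_uniq ltn_trans ltnn).
  by rewrite ltnS -[leqRHS](card_ord n) max_card.
apply: (@leq_bigmax_cond _ _ (fun k : 'I_n.+1 => k : nat) (Ordinal lt_s)).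
by apply/existsP; exists (in_tuple s).
Qed.

(** The witness is the sequence of times at which the walk, started from time
    a.+1, reaches a new maximum.  Steps have size one, so each record exceeds
    the previous one by exactly 1 and the number of records after the first
    equals the total gain in height. *)
Lemma increasing_records {n : nat} (eta : config n) (a b : 'I_n) : (a <= b)%N ->
  exists s : seq 'I_n,
    [/\ increasing_positions eta (a :: s), (last a s <= b)%N,
        height eta b.+1 <= height eta (last a s).+1 &
        height eta (last a s).+1 - height eta a.+1 <= (size s)%:Z].
Proof.
case: b => b lt_bn /= leab; elim: b lt_bn leab => [|b IHb] lt_bn leab.
  have a0 : nat_of_ord a = 0%N by lia.
  by exists [::]; rewrite /= a0 subrr; split.
have [eq_ab|lt_ab] : (nat_of_ord a = b.+1) \/ (a <= b)%N by lia.
  by exists [::]; rewrite /= eq_ab subrr; split.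
have [s [/andP[/= lt_s le_s] le_last_b top size_s]] := IHb (ltnW lt_bn) lt_ab.
have step : height eta b.+2 <= height eta b.+1 + 1.
  rewrite !heightE ?(ltnW lt_bn) //.
  rewrite (particlesS eta (Ordinal lt_bn)) /=; lia.
have [lt_new|le_new] := ltP (height eta (last a s).+1) (height eta b.+2).
  exists (rcons s (Ordinal lt_bn)).
  rewrite last_rcons size_rcons /increasing_positions /=.
  rewrite !map_rcons !rcons_path !last_map lt_s le_s /= ltnS le_last_b /=.
  by split=> //; [rewrite (last_map (fun i : 'I_n => height eta i.+1)) ltW | lia].
by exists s; split; [exact/andP | exact: leqW | |].
Qed.

(** The records of the walk on the times from n/2 to n, between which the height
    rises from 2U - n/2 to 0, where U is the particle count of the left half. *)
Lemma LIS_lower {n : nat} (eta : config n) : (0 < n)%N -> ~~ odd n ->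
  ((n./2).+1 <= LIS eta + (particles eta n./2).*2)%N.
Proof.
move=> n_gt0 n_even.
have nE : n = (n./2).*2 by rewrite -[LHS]odd_double_half (negbTE n_even).
have k_gt0 : (0 < n./2)%N by lia.
(* Index i stands for time i.+1, so times n/2 and n are indices n/2 - 1, n - 1. *)
have lt_a : ((n./2).-1 < n)%N by lia.
have lt_b : (n.-1 < n)%N by lia.
have le_ab : (Ordinal lt_a <= Ordinal lt_b)%N by rewrite /=; lia.
have [s [incr_s _ top size_s]] := increasing_records eta (Ordinal lt_a) (Ordinal lt_b) le_ab.
have := LIS_ge eta _ incr_s.
move: top size_s; rewrite /= !prednK // (heightE eta n) // particles_total.
rewrite (heightE eta n./2); lia.
Qed.

(** * Stationarity of the exclusion process *)

Lemma swap_subproof {n : nat} (i : 'I_n.-1) (eta : config n) :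
  (\sum_(j < n) swap i eta j == n./2)%N.
Proof.
have /eqP <- := valP eta; apply/eqP.
rewrite [RHS](reindex_inj (@perm_inj _ (tperm (bond_left i) (bond_right i)))) /=.
by apply: eq_bigr => j _; rewrite ffunE.
Qed.

Definition swapped {n : nat} (i : 'I_n.-1) (eta : config n) : config n :=
  Config (swap_subproof i eta).

Lemma particles_swapped_off {n : nat} (i : 'I_n.-1) (eta : config n) (m : nat) :
  m != i.+1 -> particles (swapped i eta) m = particles eta m.
Proof.
move=> m_neq; rewrite /particles.
rewrite [RHS](reindex_inj (@perm_inj _ (tperm (bond_left i) (bond_right i)))) /=.
apply: eq_big => [j|j _]; last by rewrite ffunE.
by case: tpermP => [->|->|] //=; lia.
Qed.

Lemma particles_swapped_on {n : nat} (i : 'I_n.-1) (eta : config n) :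
  particles (swapped i eta) i.+1 = (particles eta i + eta (bond_right i))%N.
Proof.
rewrite (particlesS _ (bond_left i)) particles_swapped_off /=; last by lia.
by rewrite ffunE tpermL.
Qed.

(** Invariance tested against f: the mean of f is the same before and after one
    step, and only the actual swaps contribute to the difference. *)
Lemma stationary {R : realType} {q : R} {n : nat} {mu : config n -> R}
    (f : config n -> R) : (1 < n)%N -> asep_invariant q mu ->
  Ex mu (fun eta => \sum_(i < n.-1)
           swap_prob q i eta * (f (swapped i eta) - f eta)) = 0.
Proof.
move=> n_gt1 [_ inv].
have n1_neq0 : (n.-1)%:R != 0 :> R by rewrite pnatr_eq0; lia.
have kernelE eta : \sum_xi asep_kernel q eta xi * f xi =
    f eta + (n.-1)%:R^-1 * \sum_(i < n.-1)
       swap_prob q i eta * (f (swapped i eta) - f eta).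
  transitivity ((n.-1)%:R^-1 * \sum_(i < n.-1) (f eta +
       swap_prob q i eta * (f (swapped i eta) - f eta))); last first.
    rewrite big_split /= sumr_const card_ord mulrDr; congr +%R.
    by rewrite -[f eta *+ _]mulr_natl mulKf.
  rewrite /asep_kernel; under eq_bigr do rewrite -mulrA mulr_suml.
  rewrite -mulr_sumr exchange_big /=; congr *%R; apply: eq_bigr => i _.
  under eq_bigr do rewrite mulrDl -!mulrA.
  rewrite big_split /= -!mulr_sumr.
  rewrite (bigD1 (swapped i eta)) //= eqxx mul1r big1 ?addr0; last first.
    move=> xi /negbTE neq; rewrite [occ xi == _](_ : _ = (xi == swapped i eta)) //.
    by rewrite neq mul0r.
  rewrite (bigD1 eta) //= eqxx mul1r big1 ?addr0; last first.
    by move=> xi /negbTE ->; rewrite mul0r.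
  by ring.
have : \sum_xi mu xi * f xi = \sum_eta mu eta * \sum_xi asep_kernel q eta xi * f xi.
  under eq_bigr => xi do rewrite -inv mulr_suml.
  rewrite exchange_big /=; apply: eq_bigr => eta _.
  by rewrite mulr_sumr; apply: eq_bigr => xi _; rewrite mulrA.
under [RHS]eq_bigr => eta do rewrite kernelE mulrDr mulrCA.
rewrite big_split /= -mulr_sumr /Ex => /eqP; rewrite -subr_eq0 opprD addrA subrr.
by rewrite sub0r oppr_eq0 mulf_eq0 invr_eq0 (negbTE n1_neq0) /= => /eqP.
Qed.

(** The Gärtner transform.  Only the swap across bond i changes the count of the
    first i.+1 sites, so stationarity for y ^ particles reduces to that one
    bond; since y is the ratio of the two swap probabilities, each of the four
    local occupations contributes to the mean of the generator exactly q / 2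
    times the difference of the two sides. *)
Lemma exp_particles_recurrence {R : realType} {q : R} {n : nat} {mu : config n -> R}
    (i : 'I_n.-1) : 0 < q -> asep_invariant q mu ->
  let y := (2 - q) / q in
  let z m := Ex mu (fun eta => y ^+ particles eta m) in
  z i.+2 - z i.+1 = y * (z i.+1 - z i).
Proof.
move=> q_gt0 inv y z.
have n_gt1 : (1 < n)%N by case: (i) => j; lia.
have := stationary (fun eta => y ^+ particles eta i.+1) n_gt1 inv.
have q_neq0 : q != 0 by rewrite gt_eqF.
have -> : Ex mu (fun eta => \sum_(j < n.-1) swap_prob q j eta *
      (y ^+ particles (swapped j eta) i.+1 - y ^+ particles eta i.+1))
    = q / 2 * (z i.+2 - z i.+1 - y * (z i.+1 - z i)).
  rewrite /z /Ex -!sumrB mulr_sumr -sumrB mulr_sumr; apply: eq_bigr => eta _.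
  rewrite (bigD1 i) //= big1 ?addr0; last first.
    move=> j neq_ji; rewrite particles_swapped_off ?subrr ?mulr0 //.
    by rewrite eqSS eq_sym.
  rewrite particles_swapped_on.
  rewrite (particlesS eta (bond_right i)) (particlesS eta (bond_left i)) /=.
  rewrite /swap_prob; case: (eta (bond_left i)); case: (eta (bond_right i));
    by rewrite ?addn1 ?addn0 ?exprS /y; field.
move=> /eqP; rewrite mulf_eq0 gt_eqF ?divr_gt0 //= => /eqP; lra.
Qed.

(** * Expectations *)

Lemma Ex_cst {R : realType} {T : finType} {mu : T -> R} (a : R) :
  is_distribution mu -> Ex mu (fun=> a) = a.
Proof. by case=> _ mu1; rewrite /Ex -mulr_suml mu1 mul1r. Qed.

Lemma le_Ex {R : realType} {T : finType} {mu : T -> R} (f g : T -> R) :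
  is_distribution mu -> (forall x, f x <= g x) -> Ex mu f <= Ex mu g.
Proof. by case=> mu0 _ le_fg; apply: ler_sum => x _; apply: ler_wpM2l. Qed.

Lemma Pr_le_Ex {R : realType} {T : finType} {mu : T -> R} (A : pred T)
    (f : T -> R) : is_distribution mu -> (forall x, 0 <= f x) ->
  (forall x, A x -> 1 <= f x) -> Pr mu A <= Ex mu f.
Proof.
case=> mu0 _ f0 Af; rewrite /Pr /Ex big_mkcond; apply: ler_sum => x _.
by case: ifP => Ax; [rewrite ler_peMr ?Af | rewrite mulr_ge0].
Qed.

(** * Exponential moment of the particle count of the left half *)

(** By the recurrence, z_m - 1 is proportional to the geometric sum
    1 + y + ... + y^(m-1), which gets multiplied by 1 + y^k when m goes from k to
    2k.  At m = 2k = n the count is deterministic, so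
    (1 + y^k) (z_k - 1) = y^k - 1, whence z_k - 1 <= 1. *)
Lemma exp_particles_half_le2 {R : realType} {q : R} {n : nat} {mu : config n -> R} :
    (0 < n)%N -> ~~ odd n -> 0 < q -> q < 1 -> asep_invariant q mu ->
  Ex mu (fun eta => ((2 - q) / q) ^+ particles eta n./2) <= 2.
Proof.
move=> n_gt0 n_even q_gt0 q_lt1 inv.
set y := (2 - q) / q; pose z m := Ex mu (fun eta => y ^+ particles eta m).
rewrite -/(z n./2).
have nE : n = (n./2 + n./2)%N.
  by rewrite addnn -[LHS]odd_double_half (negbTE n_even).
have y_ge0 : 0 <= y by rewrite divr_ge0; lra.
have z0 : z 0%N = 1.
  rewrite /z -[RHS](@Ex_cst _ _ mu 1); last by case: inv.
  by apply: eq_bigr => eta _; rewrite particles0.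
have zn : z n = y ^+ n./2.
  rewrite /z -[RHS](@Ex_cst _ _ mu); last by case: inv.
  by apply: eq_bigr => eta _; rewrite particles_total.
have incr m : (m < n)%N -> z m.+1 - z m = (z 1%N - z 0%N) * y ^+ m.
  elim: m => [|m IHm] lt_mn; first by rewrite mulr1.
  have lt_m : (m < n.-1)%N by lia.
  rewrite (exp_particles_recurrence (Ordinal lt_m) q_gt0 inv) -/y -/(z _) -/(z _) IHm; last by lia.
  by rewrite exprS; ring.
pose geom m := \sum_(j < m) y ^+ j.
have zE m : (m <= n)%N -> z m - z 0%N = (z 1%N - z 0%N) * geom m.
  elim: m => [|m IHm] le_mn; first by rewrite /geom big_ord0 mulr0 subrr.
  rewrite /geom big_ord_recr /= mulrDr -IHm ?(ltnW le_mn) // -incr //; ring.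
have geom_double k : geom (k + k)%N = (1 + y ^+ k) * geom k.
  rewrite /geom big_split_ord /= mulrDl mul1r mulr_sumr; congr +%R.
  by apply: eq_bigr => j _; rewrite exprD.
have : z n - z 0%N = (1 + y ^+ n./2) * (z n./2 - z 0%N).
  rewrite (zE n) // (zE n./2); last by lia.
  by rewrite [in geom n]nE geom_double mulrCA.
rewrite zn z0 => eq_z.
have yk_ge0 : 0 <= y ^+ n./2 by apply: exprn_ge0.
nra.
Qed.

(** * Concentration *)

Theorem theorem6p3 (R : realType) (n : nat) (alpha c q : R)
    (n_gt0 : (0 < n)%N) (n_even : ~~ odd n)
    (alpha_gt0 : 0 < alpha) (alpha_lt1 : alpha < 1) (c_gt0 : 0 < c)
    (q_def : q = 1 - c / n%:R `^ alpha) (q_gt0 : 0 < q) (q_lt1 : q < 1)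
    (mu : config n -> R) (mu_inv : asep_invariant q mu)
    (r : R) (r_gt0 : 0 < r) :
  let L : config n -> R := fun eta => (LIS eta)%:R in
  Pr mu (fun eta => r <= `|L eta - Ex mu L|)
    <= 6 * expR (- (r / 2) * Num.sqrt (c ^+ 2 / n%:R `^ (2 * alpha))).
Proof.
lazy zeta; set L : config n -> R := fun eta => (LIS eta)%:R.
have mu_distr : is_distribution mu by case: mu_inv.
have -> : Num.sqrt (c ^+ 2 / n%:R `^ (2 * alpha)) = 1 - q.
  rewrite [2 * alpha]mulrC powRrM powR_mulrn ?powR_ge0 // -expr_div_n.
  rewrite sqrtr_sqr ger0_norm; first by rewrite q_def; ring.
  by rewrite divr_ge0 ?powR_ge0 // ltW.
set d : R := 1 - q; have d_gt0 : 0 < d by rewrite /d; lra.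
pose U (eta : config n) : R := (particles eta n./2)%:R.
pose W (eta : config n) : R := expR (d * U eta).
have U_ge0 eta : 0 <= U eta by apply: ler0n.
(* exp (- d) >= 1 - d = q, so exp d <= 1 / q, and 1 <= 2 - q. *)
have exp_d : expR d <= (2 - q) / q.
  rewrite ler_pdivlMr // -(@ler_pM2l _ (expR (- d))) ?expR_gt0 //.
  rewrite mulrA -expRD addNr expR0 mul1r.
  have := expR_ge1Dx (- d); rewrite /d; nra.
have ExW : Ex mu W <= 2.
  apply: le_trans (exp_particles_half_le2 n_gt0 n_even q_gt0 q_lt1 mu_inv).
  apply: le_Ex => // eta; rewrite /W mulrC expRM_natl.
  by apply: lerXn2r exp_d; rewrite nnegrE ?expR_ge0 // divr_ge0; lra.
pose K : R := (n./2).+1%:R.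
have L_le eta : L eta <= K by rewrite ler_nat LIS_le.
have L_ge eta : K - 2 * U eta <= L eta.
  rewrite lerBlDr -natrM -natrD ler_nat mul2n; exact: LIS_lower.
have ExL_le : Ex mu L <= K by rewrite -(Ex_cst K mu_distr); apply: le_Ex.
(* Linearizing the exponential: d U <= W - 1 turns E W <= 2 into E U <= 1 / d. *)
have ExL_ge : d * (K - Ex mu L) <= 2.
  have le_W eta : d * (K - L eta) <= 2 * (W eta - 1).
    have := expR_ge1Dx (d * U eta); rewrite -/(W eta).
    have := L_ge eta; nra.
  have := le_Ex _ _ mu_distr le_W.
  have ExB a b f : Ex mu (fun eta => a * (f eta + b)) = a * (Ex mu f + b).
    rewrite -{2}(Ex_cst b mu_distr) /Ex -big_split /= mulr_sumr.
    by apply: eq_bigr => eta _; ring.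
  rewrite ExB.
  have -> : Ex mu (fun eta => d * (K - L eta)) = (- d) * (Ex mu L - K).
    by rewrite -ExB; apply: eq_bigr => eta _; ring.
  nra.
have [rd_le2|rd_gt2] := leP (r * d) 2.
  (* Here 6 exp (- r d / 2) >= 6 / e >= 1; splitting the exponent in two halves
     makes the linear bound exp (- 1 / 2) >= 1 / 2 sufficient. *)
  have -> : 6 * expR (- (r / 2) * d) = 6 * expR (- (r * d / 4)) ^+ 2.
    by rewrite -expRM_natl; congr (_ * expR _); field.
  apply: le_trans (_ : 1 <= _).
    by rewrite -[leRHS](Ex_cst 1 mu_distr); apply: Pr_le_Ex.
  have := expR_ge1Dx (- (r * d / 4)).
  set e := expR _ => e_ge; nra.
apply: le_trans (_ : Ex mu (fun eta => expR (- (r / 2) * d) * W eta) <= _).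
  apply: Pr_le_Ex => // [eta|eta dev]; first by rewrite mulr_ge0 ?expR_ge0.
  rewrite /W -expRD -[leLHS]expR0 ler_expR.
  move: dev; rewrite ler_normr => /orP[dev|dev].
    (* L above its mean by r is impossible: L <= K and K - E L <= 2 / d < r. *)
    have := L_le eta; nra.
  have := L_ge eta; nra.
have -> : Ex mu (fun eta => expR (- (r / 2) * d) * W eta)
    = expR (- (r / 2) * d) * Ex mu W.
  by rewrite /Ex mulr_sumr; apply: eq_bigr => eta _; ring.
have := expR_gt0 (- (r / 2) * d); nra.
Qed.
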